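(* Let $\mathfrak{g}$ be the 4-dimensional real Lie algebra with basis $\{e_1,e_2,e_3,e_4\}$ whose nonzero brackets of basis vectors are determined (up to antisymmetry) by $$[e_1,e_2]=e_2,\qquad [e_1,e_3]=\tfrac12 e_3,\qquad [e_1,e_4]=\tfrac12 e_4,\qquad [e_3,e_4]=\tfrac12 e_2,$$ and let $(G,H,g)$, $H=(J_1,J_2,J_3)$, be the corresponding Lie group equipped with the standard left-invariant structure $(J_1,J_2,J_3,g)$ described in the context. Then $(G,H,g)$ belongs to the class $$\mathcal{H}=\mathcal{W}_4(J_1)\cap(\mathcal{W}_1\oplus\mathcal{W}_2)(J_2)\cap(\mathcal{W}_1\oplus\mathcal{W}_2)(J_3)$$ of hypercomplex manifolds with Hermitian-Norden metrics, and, for each $\alpha\in\{2,3\}$, it belongs neither to $\mathcal{W}_1(J_\alpha)$ nor to $\mathcal{W}_2(J_\alpha)$.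
   Context: Standard structure: given a 4-dimensional real Lie algebra $\mathfrak{g}$ with a fixed basis $\{e_1,e_2,e_3,e_4\}$, let $G$ be the simply connected Lie group with Lie algebra $\mathfrak{g}$, and regard elements of $\mathfrak{g}$ as left-invariant vector fields on $G$. Define left-invariant endomorphisms $$J_1e_1=e_2,\ J_1e_2=-e_1,\ J_1e_3=-e_4,\ J_1e_4=e_3;$$ $$J_2e_1=e_3,\ J_2e_2=e_4,\ J_2e_3=-e_1,\ J_2e_4=-e_2;$$ $$J_3e_1=-e_4,\ J_3e_2=e_3,\ J_3e_3=-e_2,\ J_3e_4=e_1,$$ and the left-invariant neutral metric $g$ with $g(x,y)=x^1y^1+x^2y^2-x^3y^3-x^4y^4$ for $x=\sum x^ie_i$, $y=\sum y^ie_i$. Then $g(x,y)=\varepsilon_\alpha g(J_\alpha x,J_\alpha y)$ with $\varepsilon_1=1$, $\varepsilon_2=\varepsilon_3=-1$. Structure tensors: let $\nabla$ be the Levi-Civita connection of $g$. For $\alpha=1,2,3$ put $F_\alpha(x,y,z)=g((\nabla_xJ_\alpha)y,z)$ and $\theta_\alpha(z)=g^{ij}F_\alpha(e_i,e_j,z)$, where $(g^{ij})$ is the inverse matrix of $(g(e_i,e_j))$ (summation convention). Classes (dimension 4; conditions are for all $x,y,z$; $\mathfrak{S}_{x,y,z}$ is the cyclic sum): - $\mathcal{W}_4(J_1)$: $F_1(x,y,z)=\frac12\{g(x,y)\theta_1(z)-g(x,z)\theta_1(y)-g(x,J_1y)\theta_1(J_1z)+g(x,J_1z)\theta_1(J_1y)\}$.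 - $\mathcal{W}_1(J_\alpha)$, $\alpha=2,3$: $F_\alpha(x,y,z)=\frac14\{g(x,y)\theta_\alpha(z)+g(x,z)\theta_\alpha(y)+g(x,J_\alpha y)\theta_\alpha(J_\alpha z)+g(x,J_\alpha z)\theta_\alpha(J_\alpha y)\}$. - $\mathcal{W}_2(J_\alpha)$, $\alpha=2,3$: $\mathfrak{S}_{x,y,z}F_\alpha(x,y,J_\alpha z)=0$ and $\theta_\alpha=0$. - $(\mathcal{W}_1\oplus\mathcal{W}_2)(J_\alpha)$, $\alpha=2,3$: the class of complex manifolds with Norden metric, i.e. the Nijenhuis tensor $N_\alpha(x,y)=[J_\alpha x,J_\alpha y]-J_\alpha[J_\alpha x,y]-J_\alpha[x,J_\alpha y]-[x,y]$ vanishes. *)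

(* Defs.v *)
From HB Require Import structures.
From mathcomp Require Import all_boot all_order all_algebra.
From mathcomp Require Import all_classical all_reals all_analysis.

Set Implicit Arguments.
Unset Strict Implicit.
Unset Printing Implicit Defensive.

Import Order.TTheory GRing.Theory Num.Theory.
Import numFieldNormedType.Exports.

Local Open Scope ring_scope.

(* The underlying manifold of all the groups below is R^4, with its global
   chart.  This is the general case up to isomorphism: a simply connected
   solvable Lie group of dimension 4 is diffeomorphic to R^4.  Basis vectors
   e_1, ..., e_4 carry the indices 0, ..., 3 of 'I_4. *)
Notation R4 R := ('rV[R]_4).

(** * Smooth maps, functions and vector fields *)

(* C^k.+1 means: differentiable, with all directional derivatives C^k.  It is
   used below only on the finite-dimensional domains R^4 and R^4 x R^4. *)
Fixpoint is_Ck (R : realType) (U W : normedModType R) (k : nat) (f : U -> W)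
    : Prop :=
  match k with
  | 0%N => continuous f
  | k'.+1 => (forall x : U, differentiable f x) /\
             (forall v : U, is_Ck k' (fun x => 'D_v f x))
  end.

Definition smooth (R : realType) (U W : normedModType R) (f : U -> W) : Prop :=
  forall k, is_Ck k f.

Definition scalar_field (R : realType) : Type := R4 R -> R.
Definition vfield (R : realType) : Type := R4 R -> R4 R.

Definition smooth_function (R : realType) (f : scalar_field R) : Prop :=
  smooth (f : R4 R -> R^o).
Definition smooth_field (R : realType) (X : vfield R) : Prop :=
  smooth (X : R4 R -> R4 R).

Definition fadd (R : realType) (X Y : vfield R) : vfield R := fun p => X p + Y p.
Definition fsub (R : realType) (X Y : vfield R) : vfield R := fun p => X p - Y p.
Definition fscale (R : realType) (f : scalar_field R) (X : vfield R) : vfield R :=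
  fun p => f p *: X p.

(* The derivative X f. *)
Definition lie_deriv (R : realType) (X : vfield R) (f : scalar_field R)
    : scalar_field R :=
  fun p => 'D_(X p) (f : R4 R -> R^o) p.

(* In the global chart, [X, Y]^k = X^i d_i Y^k - Y^i d_i X^k. *)
Definition bracket (R : realType) (X Y : vfield R) : vfield R :=
  fun p => 'D_(X p) Y p - 'D_(Y p) X p.

(** * Lie groups and left-invariant fields *)

Record lie_group (R : realType) := LieGroup {
  lmul : R4 R -> R4 R -> R4 R;
  lone : R4 R;
  linv : R4 R -> R4 R;
  lmulA : forall a b c, lmul a (lmul b c) = lmul (lmul a b) c;
  lmul1 : forall a, lmul lone a = a;
  lmulV : forall a, lmul (linv a) a = lone;
  lmul_smooth : smooth (fun ab : R4 R * R4 R => lmul ab.1 ab.2);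
  linv_smooth : smooth linv
}.

(* X (a p) = d(L_a)_p (X p), where L_a is the left translation by a. *)
Definition left_invariant (R : realType) (G : lie_group R) (X : vfield R)
    : Prop :=
  smooth_field X /\ forall a p, X (lmul G a p) = 'd (lmul G a) p (X p).

Definition frame (R : realType) : Type := 'I_4 -> vfield R.

(* e is a basis of the Lie algebra of G, i.e. of the left-invariant fields. *)
Definition lie_basis (R : realType) (G : lie_group R) (e : frame R) : Prop :=
  (forall i, left_invariant G (e i)) /\
  (forall X, left_invariant G X ->
     exists! c : R4 R, forall p, X p = \sum_(i < 4) c 0 i *: e i p).

Definition brackets_g (R : realType) (e : frame R) : Prop :=
  let e1 := e 0 in let e2 := e 1 in let e3 := e 2%:R in let e4 := e 3%:R in
  forall p,
  [/\ bracket e1 e2 p = e2 p,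
      bracket e1 e3 p = 2^-1 *: e3 p &
      bracket e1 e4 p = 2^-1 *: e4 p] /\
  [/\ bracket e2 e3 p = 0,
      bracket e2 e4 p = 0 &
      bracket e3 e4 p = 2^-1 *: e2 p].

(** * The left-invariant tensors J_1, J_2, J_3 and g *)

(* The row (v^1, ..., v^4) with v = \sum_i v^i e_i(p); row i of the matrix
   below, before inversion, is e_i(p). *)
Definition coord (R : realType) (e : frame R) (p v : R4 R) : R4 R :=
  v *m invmx (\matrix_(i < 4) e i p).

(* A field of bilinear forms, resp. of endomorphisms, on the tangent spaces;
   the first argument is the base point. *)
Definition bilinear_field (R : realType) : Type := R4 R -> R4 R -> R4 R -> R.
Definition endo_field (R : realType) : Type := R4 R -> R4 R -> R4 R.

Definition endo_app (R : realType) (J : endo_field R) (X : vfield R) : vfield R :=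
  fun p => J p (X p).
Definition eval_metric (R : realType) (g : bilinear_field R) (X Y : vfield R)
    : scalar_field R :=
  fun p => g p (X p) (Y p).

Definition metric (R : realType) (e : frame R) : bilinear_field R :=
  fun p v w =>
    let x := coord e p v 0 in let y := coord e p w 0 in
    x 0 * y 0 + x 1 * y 1 - x 2%:R * y 2%:R - x 3%:R * y 3%:R.

(* The left-invariant endomorphism mapping e_1, ..., e_4 to a, b, c, d. *)
Definition endo (R : realType) (e : frame R) (a b c d : vfield R)
    : endo_field R :=
  fun p v =>
    let x := coord e p v 0 in
    x 0 *: a p + x 1 *: b p + x 2%:R *: c p + x 3%:R *: d p.

Definition fopp (R : realType) (X : vfield R) : vfield R := fun p => - X p.

Definition J1 (R : realType) (e : frame R) : endo_field R :=
  endo e (e 1) (fopp (e 0)) (fopp (e 3%:R)) (e 2%:R).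
Definition J2 (R : realType) (e : frame R) : endo_field R :=
  endo e (e 2%:R) (e 3%:R) (fopp (e 0)) (fopp (e 1)).
Definition J3 (R : realType) (e : frame R) : endo_field R :=
  endo e (fopp (e 3%:R)) (e 2%:R) (fopp (e 1)) (e 0).

(** * The Levi-Civita connection *)

Record connection (R : realType) (D : vfield R -> vfield R -> vfield R) : Prop :=
Connection {
  conn_smooth : forall X Y, smooth_field X -> smooth_field Y ->
    smooth_field (D X Y);
  conn_addl : forall X X' Y,
    smooth_field X -> smooth_field X' -> smooth_field Y ->
    D (fadd X X') Y = fadd (D X Y) (D X' Y);
  conn_scalel : forall f X Y,
    smooth_function f -> smooth_field X -> smooth_field Y ->
    D (fscale f X) Y = fscale f (D X Y);
  conn_addr : forall X Y Y',
    smooth_field X -> smooth_field Y -> smooth_field Y' ->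
    D X (fadd Y Y') = fadd (D X Y) (D X Y');
  conn_leibniz : forall f X Y,
    smooth_function f -> smooth_field X -> smooth_field Y ->
    D X (fscale f Y) = fadd (fscale (lie_deriv X f) Y) (fscale f (D X Y))
}.

Definition torsion_free (R : realType) (D : vfield R -> vfield R -> vfield R)
    : Prop :=
  forall X Y, smooth_field X -> smooth_field Y ->
    fsub (D X Y) (D Y X) = bracket X Y.

Definition metric_compatible (R : realType) (g : bilinear_field R)
    (D : vfield R -> vfield R -> vfield R) : Prop :=
  forall X Y Z, smooth_field X -> smooth_field Y -> smooth_field Z ->
    forall p,
    lie_deriv X (eval_metric g Y Z) p = eval_metric g (D X Y) Z p + eval_metric g Y (D X Z) p.

Definition levi_civita (R : realType) (g : bilinear_field R)
    (D : vfield R -> vfield R -> vfield R) : Prop :=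
  [/\ connection D, torsion_free D & metric_compatible g D].

(** * Structure tensors and classes *)

(* (nabla_X J) Y *)
Definition nablaJ (R : realType) (D : vfield R -> vfield R -> vfield R)
    (J : endo_field R) (X Y : vfield R) : vfield R :=
  fsub (D X (endo_app J Y)) (endo_app J (D X Y)).

Definition Ftensor (R : realType) (g : bilinear_field R)
    (D : vfield R -> vfield R -> vfield R) (J : endo_field R) (X Y Z : vfield R)
    : scalar_field R :=
  eval_metric g (nablaJ D J X Y) Z.

Definition theta (R : realType) (e : frame R) (g : bilinear_field R)
    (D : vfield R -> vfield R -> vfield R) (J : endo_field R) (Z : vfield R)
    : scalar_field R :=
  fun p =>
    \sum_(i < 4) \sum_(j < 4)
      invmx (\matrix_(k < 4, l < 4) eval_metric g (e k) (e l) p) i j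
        * Ftensor g D J (e i) (e j) Z p.

Definition nijenhuis (R : realType) (J : endo_field R) (X Y : vfield R)
    : vfield R :=
  fsub (fsub (fsub (bracket (endo_app J X) (endo_app J Y)) (endo_app J (bracket (endo_app J X) Y)))
             (endo_app J (bracket X (endo_app J Y))))
       (bracket X Y).

(* Class W_4 of almost Hermitian structures (used for J_1). *)
Definition class_W4 (R : realType) (e : frame R) (g : bilinear_field R)
    (D : vfield R -> vfield R -> vfield R) (J : endo_field R) : Prop :=
  forall X Y Z, smooth_field X -> smooth_field Y -> smooth_field Z ->
  forall p,
    Ftensor g D J X Y Z p =
    2^-1 * (eval_metric g X Y p * theta e g D J Z p
            - eval_metric g X Z p * theta e g D J Y p
            - eval_metric g X (endo_app J Y) p * theta e g D J (endo_app J Z) p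
            + eval_metric g X (endo_app J Z) p * theta e g D J (endo_app J Y) p).

(* Classes W_1, W_2, W_1 + W_2 of almost Norden structures (used for J_2 and
   J_3). *)
Definition class_W1 (R : realType) (e : frame R) (g : bilinear_field R)
    (D : vfield R -> vfield R -> vfield R) (J : endo_field R) : Prop :=
  forall X Y Z, smooth_field X -> smooth_field Y -> smooth_field Z ->
  forall p,
    Ftensor g D J X Y Z p =
    4^-1 * (eval_metric g X Y p * theta e g D J Z p
            + eval_metric g X Z p * theta e g D J Y p
            + eval_metric g X (endo_app J Y) p * theta e g D J (endo_app J Z) p
            + eval_metric g X (endo_app J Z) p * theta e g D J (endo_app J Y) p).

Definition class_W2 (R : realType) (e : frame R) (g : bilinear_field R)
    (D : vfield R -> vfield R -> vfield R) (J : endo_field R) : Prop :=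
  (forall X Y Z, smooth_field X -> smooth_field Y -> smooth_field Z ->
   forall p,
     Ftensor g D J X Y (endo_app J Z) p + Ftensor g D J Y Z (endo_app J X) p
       + Ftensor g D J Z X (endo_app J Y) p = 0) /\
  (forall Z, smooth_field Z -> forall p, theta e g D J Z p = 0).

Definition class_W1W2 (R : realType) (J : endo_field R) : Prop :=
  forall X Y, smooth_field X -> smooth_field Y ->
  forall p, nijenhuis J X Y p = 0.

Definition class_H (R : realType) (e : frame R)
    (D : vfield R -> vfield R -> vfield R) : Prop :=
  [/\ class_W4 e (metric e) D (J1 e), class_W1W2 (J2 e) & class_W1W2 (J3 e)].

(* Main.v *)
(* At every point a basis of left-invariant fields is a basis of the tangent
   space, because left translations are transitive and the coefficients of a
   left-invariant field are unique.  The components of a smooth field in the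
   frame are smooth (Cramer's rule), so any field can be expanded over the frame
   with smooth coefficients.  On the frame, absence of torsion and constancy of
   the metric coefficients determine the connection: the difference of two
   candidates, lowered to a trilinear form, is symmetric in its first two
   arguments and skew in its last two, hence zero.  Therefore
   [nabla_X Y = X(Y^k) e_k + Gamma(X, Y)] with constant Gamma; the derivative
   terms cancel in [nabla J] and, as [J^2 = -1], in the Nijenhuis tensor.  What
   remains are polynomial identities in the components of X, Y, Z.  With theta_2
   = 3 e^3 and theta_3 = -3 e^4 the Lee forms exclude W_2, while
   F_2(e_2, e_1, e_4) and F_3(e_2, e_1, e_3) exclude W_1. *)
From HB Require Import structures.
From Pilot Require Import Defs.
From mathcomp Require Import all_boot all_order all_algebra.
From mathcomp Require Import all_classical all_reals all_analysis.
From mathcomp Require Import ring lra.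

(* [coord] would otherwise denote the coordinates of vector.v. *)
Import Pilot.Defs.

Set Implicit Arguments.
Unset Strict Implicit.
Unset Printing Implicit Defensive.

Import GRing.Theory numFieldNormedType.Exports.

Local Open Scope ring_scope.

(** * Calculus of C^k maps *)

Section Ck.
Variables (R : realType).
Implicit Types U V W : normedModType R.

(** Products and inverses need this: their derivatives still contain the undifferentiated
    functions. *)
Lemma is_Ck_pred U W k (f : U -> W) : is_Ck k.+1 f -> is_Ck k f.
Proof.
elim: k f => [|k IH] f [df Df] /=.
  by move=> x; exact: differentiable_continuous.
by split=> // v; exact: IH.
Qed.

Lemma is_Ck_cst U W k (c : W) : is_Ck k (fun _ : U => c).
Proof.
elim: k c => [|k IH] c /=; first by move=> x; exact: cst_continuous.
split=> [x|v]; first exact: differentiable_cst.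
rewrite (_ : (fun x => _) = (fun _ : U => 0 : W)).
  exact: IH.
by apply/funext => x; exact: derive_cst.
Qed.

Lemma is_CkD U W k (f g : U -> W) :
  is_Ck k f -> is_Ck k g -> is_Ck k (fun x => f x + g x).
Proof.
elim: k f g => [|k IH] f g /=.
  by move=> cf cg x; apply: cvgD; [exact: cf|exact: cg].
move=> [df Df] [dg Dg]; split=> [x|v]; first exact: differentiableD.
rewrite (_ : (fun x => _) = fun x => 'D_v f x + 'D_v g x); first exact: IH.
by apply/funext => x; rewrite deriveD //; exact: diff_derivable.
Qed.

Lemma is_Ck_sum U W k (I : Type) (r : seq I) (P : pred I) (f : I -> U -> W) :
  (forall i, is_Ck k (f i)) -> is_Ck k (fun x => \sum_(i <- r | P i) f i x).
Proof.
move=> hf; elim: r => [|i r IH].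
  by under eq_fun do rewrite big_nil; exact: is_Ck_cst.
by under eq_fun do rewrite big_cons; case: (P i); [exact: is_CkD|].
Qed.

Lemma is_Ck_linear U V W k (L : {linear V -> W}) (f : U -> V) :
  continuous L -> is_Ck k f -> is_Ck k (fun x => L (f x)).
Proof.
move=> cL; have dL y : differentiable L y by exact: linear_differentiable.
elim: k f => [|k IH] f /=.
  by move=> cf x; apply: continuous_comp; [exact: cf|exact: cL].
move=> [df Df]; split=> [x|v]; first exact: differentiable_comp.
rewrite (_ : (fun x => _) = fun x => L ('D_v f x)); first exact: IH.
apply/funext => x; rewrite !deriveE //; last exact: differentiable_comp.
by rewrite (diff_comp (df x) (dL _)) /= diff_lin.
Qed.

Lemma is_CkM U k (f g : U -> R^o) :
  is_Ck k f -> is_Ck k g -> is_Ck k (fun x => f x * g x : R^o).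
Proof.
elim: k f g => [|k IH] f g.
  by move=> cf cg x; apply: cvgM; [exact: cf|exact: cg].
move=> hf hg; have cf := is_Ck_pred hf; have cg := is_Ck_pred hg.
case: hf hg => [df Df] [dg Dg]; split=> [x|v]; first exact: differentiableM.
rewrite (_ : (fun x => _) = fun x => f x * 'D_v g x + g x * 'D_v f x).
  apply: is_CkD; [apply: (IH f ('D_v g)) => //; exact: Dg|].
  by apply: (IH g ('D_v f)) => //; exact: Df.
by apply/funext => x; rewrite deriveM //; exact: diff_derivable.
Qed.

Lemma is_CkV U k (f : U -> R^o) :
  (forall x, f x != 0) -> is_Ck k f -> is_Ck k (fun x => (f x)^-1 : R^o).
Proof.
move=> f0; elim: k => [|k IH].
  by move=> cf x; apply: cvgV => //; exact: cf.
move=> hf; have cf := IH (is_Ck_pred hf).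
case: hf => [df Df]; split=> [x|v]; first exact: differentiableV.
(* The derivative of 1/f is -(1/f)^2 f', where 1/f is C^k by the induction hypothesis. *)
rewrite (_ : (fun x => _) = fun x => (-1) * ((f x)^-1 * (f x)^-1 * 'D_v f x)).
  apply: is_CkM; first exact: is_Ck_cst.
  apply: (is_CkM _ (Df v)); exact: is_CkM.
apply/funext => x; rewrite deriveV //; last exact: diff_derivable.
by rewrite mulN1r scaleNr -expr2 exprVn.
Qed.

Lemma is_Ck_prod U k (I : Type) (r : seq I) (P : pred I) (f : I -> U -> R^o) :
  (forall i, is_Ck k (f i)) ->
  is_Ck k (fun x => \prod_(i <- r | P i) f i x : R^o).
Proof.
move=> hf; elim: r => [|i r IH].
  by under eq_fun do rewrite big_nil; exact: is_Ck_cst.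
by under eq_fun do rewrite big_cons; case: (P i); [exact: is_CkM|].
Qed.

Lemma is_Ck_det U k n (M : U -> 'M[R]_n) :
  (forall i j, is_Ck k (fun x => M x i j : R^o)) ->
  is_Ck k (fun x => \det (M x) : R^o).
Proof.
move=> hM; apply: is_Ck_sum => s; apply: is_CkM; first exact: is_Ck_cst.
by apply: is_Ck_prod => i; exact: hM.
Qed.

Lemma is_Ck_invmx U k n (M : U -> 'M[R]_n) :
  (forall x, M x \in unitmx) ->
  (forall i j, is_Ck k (fun x => M x i j : R^o)) ->
  forall i j, is_Ck k (fun x => invmx (M x) i j : R^o).
Proof.
move=> uM hM i j.
(* Adjugate over determinant; [i] and [j] are swapped because the adjugate is the transposed
   cofactor matrix. *)
rewrite (_ : (fun x => _) = fun x => (\det (M x))^-1 *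
    ((-1) ^+ (j + i) * \det (row' j (col' i (M x))))); last first.
  by apply/funext => x; rewrite /invmx uM !mxE.
apply: is_CkM.
  by apply: is_CkV; [move=> x; rewrite -unitfE -unitmxE|exact: is_Ck_det].
apply: is_CkM; first exact: is_Ck_cst.
apply: is_Ck_det => a b.
rewrite (_ : (fun x => _) = fun x => M x (lift j a) (lift i b)).
  exact: hM.
by apply/funext => x; rewrite !mxE.
Qed.

Lemma is_Ck_scaler U W k (f : U -> R^o) (w : W) :
  is_Ck k f -> is_Ck k (fun x => f x *: w).
Proof.
elim: k f => [|k IH] f.
  by move=> cf x; apply: cvgZr_tmp; exact: cf.
case=> [df Df]; split=> [x|v]; first exact: differentiableZl.
rewrite (_ : (fun x => _) = fun x => 'D_v f x *: w); first exact: (IH _ (Df v)).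
apply/funext => x; rewrite !deriveE //; last exact: differentiableZl.
by rewrite diffZl.
Qed.

Lemma is_Ck_entry U k m n (f : U -> 'M[R]_(m.+1, n.+1)) i j :
  is_Ck k f -> is_Ck k (fun x => f x i j : R^o).
Proof.
pose L : 'M[R]_(m.+1, n.+1) -> R^o := fun A => A i j.
have linL : linear L by move=> c A B; rewrite /L !mxE.
pose HL := GRing.isLinear.Build _ _ _ _ L linL.
pose L' : {linear _ -> _} := HB.pack L HL.
by apply: (@is_Ck_linear _ _ _ _ L'); exact: coord_continuous.
Qed.

Lemma is_Ck_row U k n (f : U -> 'rV[R]_n.+1) :
  (forall j, is_Ck k (fun x => f x 0 j : R^o)) -> is_Ck k f.
Proof.
move=> hf; rewrite (_ : f = fun x => \sum_j f x 0 j *: delta_mx 0 j).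
  by apply: is_Ck_sum => j; exact: is_Ck_scaler.
by apply/funext => x; exact: row_sum_delta.
Qed.
End Ck.

(** * Left-invariant frames *)

Lemma sum_ord4 (V : nmodType) (f : 'I_4 -> V) :
  \sum_(i < 4) f i = f 0 + f 1 + f 2%:R + f 3%:R.
Proof.
rewrite !big_ord_recr big_ord0 /= add0r.
by congr (f _ + f _ + f _ + f _); exact: val_inj.
Qed.

Lemma forall_ord4 (P : 'I_4 -> Prop) :
  P 0 -> P 1 -> P 2%:R -> P 3%:R -> forall i, P i.
Proof.
move=> h0 h1 h2 h3; case=> -[|[|[|[|//]]]] hi.
- by rewrite (_ : Ordinal hi = 0) //; exact: val_inj.
- by rewrite (_ : Ordinal hi = 1) //; exact: val_inj.
- by rewrite (_ : Ordinal hi = 2%:R) //; exact: val_inj.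
- by rewrite (_ : Ordinal hi = 3%:R) //; exact: val_inj.
Qed.

Lemma transitive_left_translations (R : realType) (G : lie_group R) p q :
  exists a, lmul G a p = q.
Proof.
(* Only left inverses are given: with x' and x'' the successive inverses, x x' = (x'' x')(x x') =
   x'' (x' x) x' = x'' x' = 1. *)
have mulV x : lmul G x (linv G x) = lone G.
  rewrite -[LHS](lmul1 G) -[X in lmul G X _](lmulV G (linv G x)) -lmulA.
  by rewrite [lmul G (linv G x) _]lmulA lmulV lmul1 lmulV.
exists (lmul G q (linv G p)); rewrite -lmulA lmulV -(lmulV G q) lmulA mulV.
exact: lmul1.
Qed.

Lemma frame_unitmx (R : realType) (G : lie_group R) (e : frame R) p :
  lie_basis G e -> \matrix_(i < 4) e i p \in unitmx.
Proof.
move=> [inv uniq]; rewrite -row_free_unit; apply: inj_row_free => v.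
rewrite mulmx_sum_row; under eq_bigr do rewrite rowK.
move=> v0.
have zero : left_invariant G (fun _ => 0 : 'rV[R]_4).
  by split=> [k|a q]; [exact: is_Ck_cst|rewrite linear0].
have [c [_ cuniq]] := uniq _ zero.
(* The differentials of left translations carry the relation from [p] to every point, so [v] and 0
   are both coefficient vectors of the zero field. *)
rewrite -[v]cuniq; last first.
  move=> q; have [a <-] := transitive_left_translations G p q.
  under eq_bigr do rewrite (inv _).2 -linearZ.
  by rewrite -linear_sum v0 linear0.
by apply: cuniq => q; rewrite big1 // => i _; rewrite mxE scale0r.
Qed.

(** * Components with respect to a smooth frame *)

Section Coordinates.
Variables (R : realType) (e : frame R).
Hypothesis e_smooth : forall i, smooth_field (e i).
Hypothesis e_unit : forall p, \matrix_(i < 4) e i p \in unitmx.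

Lemma coordK p v : \sum_(i < 4) coord e p v 0 i *: e i p = v.
Proof.
rewrite -[RHS](mulmxKV (e_unit p)) mulmx_sum_row.
by apply: eq_bigr => i _; rewrite rowK.
Qed.

Lemma coord_inj p : injective (coord e p).
Proof. by move=> v w vw; rewrite -(coordK p v) vw coordK. Qed.

Lemma coord_frame p i : coord e p (e i p) = delta_mx 0 i.
Proof.
rewrite -[e i p](rowK (fun i => e i p)) /coord -row_mul mulmxV //.
by rewrite row1.
Qed.

Lemma coordD p v w : coord e p (v + w) = coord e p v + coord e p w.
Proof. exact: mulmxDl. Qed.

Lemma coordB p v w : coord e p (v - w) = coord e p v - coord e p w.
Proof. exact: mulmxBl. Qed.

Lemma coordZ p c v : coord e p (c *: v) = c *: coord e p v.
Proof. by rewrite /coord scalemxAl. Qed.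

Definition component (X : vfield R) (i : 'I_4) : scalar_field R :=
  fun p => coord e p (X p) 0 i.

Lemma smooth_component X i : smooth_field X -> smooth_function (component X i).
Proof.
move=> sX k; rewrite /component /coord.
under eq_fun do rewrite mxE.
apply: is_Ck_sum => j; apply: is_CkM; first exact: is_Ck_entry.
apply: is_Ck_invmx => // a b.
rewrite (_ : (fun x => _) = fun x => e a x 0 b); last first.
  by apply/funext => x; rewrite mxE.
by apply: is_Ck_entry; exact: e_smooth.
Qed.

Lemma smooth_fscale (f : scalar_field R) (X : vfield R) :
  smooth_function f -> smooth_field X -> smooth_field (fscale f X).
Proof.
move=> sf sX k; apply: is_Ck_row => j.
rewrite /fscale; under eq_fun do rewrite mxE.
by apply: is_CkM => //; exact: is_Ck_entry.
Qed.

Lemma smooth_fadd (X Y : vfield R) :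
  smooth_field X -> smooth_field Y -> smooth_field (fadd X Y).
Proof. by move=> sX sY k; exact: is_CkD. Qed.

(** Nested [fadd] instead of a big sum lets the connection axioms rewrite the expansion directly. *)
Lemma field_expand X :
  X = fadd (fadd (fadd (fscale (component X 0) (e 0))
                       (fscale (component X 1) (e 1)))
                 (fscale (component X 2%:R) (e 2%:R)))
           (fscale (component X 3%:R) (e 3%:R)).
Proof. by apply/funext => p; rewrite -[LHS](coordK p) sum_ord4. Qed.

End Coordinates.

(** * The algebra of the frame components *)

Section Algebra.
Variable R : realType.
Implicit Types x y z : 'rV[R]_4.

Definition vec4 (a b c d : R) : 'rV[R]_4 := \row_j [:: a; b; c; d]`_j.

Lemma vec4E a b c d :
  (vec4 a b c d 0 0 = a) * (vec4 a b c d 0 1 = b) *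
  (vec4 a b c d 0 2%:R = c) * (vec4 a b c d 0 3%:R = d).
Proof. by rewrite !mxE. Qed.

Lemma row4P x y : x 0 0 = y 0 0 -> x 0 1 = y 0 1 -> x 0 2%:R = y 0 2%:R ->
  x 0 3%:R = y 0 3%:R -> x = y.
Proof. by move=> *; apply/rowP; apply: forall_ord4. Qed.

Definition neutral x y : R :=
  x 0 0 * y 0 0 + x 0 1 * y 0 1 - x 0 2%:R * y 0 2%:R - x 0 3%:R * y 0 3%:R.

(* The components of [nabla_x y] for left-invariant fields with components [x]
   and [y]. *)
Definition christoffel x y : 'rV[R]_4 :=
  vec4
    (x 0 1 * y 0 1 - 2^-1 * (x 0 2%:R * y 0 2%:R + x 0 3%:R * y 0 3%:R))
    (4^-1 * (x 0 2%:R * y 0 3%:R - x 0 3%:R * y 0 2%:R) - x 0 1 * y 0 0)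
    (- 2^-1 * (x 0 2%:R * y 0 0)
       - 4^-1 * (x 0 3%:R * y 0 1 + x 0 1 * y 0 3%:R))
    (4^-1 * (x 0 2%:R * y 0 1 + x 0 1 * y 0 2%:R)
       - 2^-1 * (x 0 3%:R * y 0 0)).

Lemma christoffel_vec4 a b c d a' b' c' d' :
  christoffel (vec4 a b c d) (vec4 a' b' c' d') =
  vec4 (b * b' - 2^-1 * (c * c' + d * d')) (4^-1 * (c * d' - d * c') - b * a')
    (- 2^-1 * (c * a') - 4^-1 * (d * b' + b * d'))
    (4^-1 * (c * b' + b * c') - 2^-1 * (d * a')).
Proof. by rewrite /christoffel !vec4E. Qed.

Definition mat4 (a b c d : 'rV[R]_4) : 'M[R]_4 :=
  \matrix_i [:: a; b; c; d]`_i.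

Lemma mul_mat4 x a b c d : x *m mat4 a b c d =
  x 0 0 *: a + x 0 1 *: b + x 0 2%:R *: c + x 0 3%:R *: d.
Proof. by rewrite mulmx_sum_row sum_ord4 !rowK. Qed.

(** Row i holds the components of the image of the i-th frame vector, so the endomorphism acts on
    rows by right multiplication. *)
Definition mat_J1 : 'M[R]_4 :=
  mat4 (delta_mx 0 1) (- delta_mx 0 0) (- delta_mx 0 3%:R) (delta_mx 0 2%:R).
Definition mat_J2 : 'M[R]_4 :=
  mat4 (delta_mx 0 2%:R) (delta_mx 0 3%:R) (- delta_mx 0 0) (- delta_mx 0 1).
Definition mat_J3 : 'M[R]_4 :=
  mat4 (- delta_mx 0 3%:R) (delta_mx 0 2%:R) (- delta_mx 0 1) (delta_mx 0 0).

Lemma mul_mat_J1 x : x *m mat_J1 =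
  vec4 (- x 0 1) (x 0 0) (x 0 3%:R) (- x 0 2%:R).
Proof.
by rewrite mul_mat4; apply: row4P; rewrite vec4E !mxE !eqxx /=; ring.
Qed.

Lemma mul_mat_J2 x : x *m mat_J2 =
  vec4 (- x 0 2%:R) (- x 0 3%:R) (x 0 0) (x 0 1).
Proof.
by rewrite mul_mat4; apply: row4P; rewrite vec4E !mxE !eqxx /=; ring.
Qed.

Lemma mul_mat_J3 x : x *m mat_J3 =
  vec4 (x 0 3%:R) (- x 0 2%:R) (x 0 1) (- x 0 0).
Proof.
by rewrite mul_mat4; apply: row4P; rewrite vec4E !mxE !eqxx /=; ring.
Qed.

Lemma vec4B a b c d a' b' c' d' :
  vec4 a b c d - vec4 a' b' c' d' = vec4 (a - a') (b - b') (c - c') (d - d').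
Proof. by apply: row4P; rewrite [LHS]mxE [X in _ + X]mxE !vec4E. Qed.

Lemma delta4E :
  (delta_mx 0 0 = vec4 1 0 0 0) * (delta_mx 0 1 = vec4 0 1 0 0) *
  (delta_mx 0 2%:R = vec4 0 0 1 0) * (delta_mx 0 3%:R = vec4 0 0 0 1).
Proof. by split; [split; [split|]|]; apply: row4P; rewrite !mxE. Qed.

(** The components of (nabla_x J) y when J has the constant matrix [M] in the frame. *)
Definition cov_J (M : 'M[R]_4) x y : 'rV[R]_4 :=
  christoffel x (y *m M) - christoffel x y *m M.

(** The signs are those of the inverse metric diag(1, 1, -1, -1). *)
Definition lee_form (M : 'M[R]_4) z : R :=
  neutral (cov_J M (delta_mx 0 0) (delta_mx 0 0)) z
  + neutral (cov_J M (delta_mx 0 1) (delta_mx 0 1)) z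
  - neutral (cov_J M (delta_mx 0 2%:R) (delta_mx 0 2%:R)) z
  - neutral (cov_J M (delta_mx 0 3%:R) (delta_mx 0 3%:R)) z.

Definition frame_simp := (delta4E, vec4E, vec4B).

(** Metric compatibility for constant components; with [coord_bracket_frame], which expresses
    absence of torsion, it characterizes [christoffel]. *)
Lemma christoffel_metric x y z :
  neutral (christoffel x y) z + neutral y (christoffel x z) = 0.
Proof. rewrite /neutral /christoffel !vec4E; ring. Qed.

Lemma lee_form_J1 z : lee_form mat_J1 z = - 2^-1 * z 0 1.
Proof.
rewrite /lee_form /cov_J !delta4E !christoffel_vec4 !mul_mat_J1 !vec4E.
by rewrite !christoffel_vec4 !vec4B /neutral !vec4E; field.
Qed.

Lemma lee_form_J2 z : lee_form mat_J2 z = 3 * z 0 2%:R.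
Proof.
rewrite /lee_form /cov_J !delta4E !christoffel_vec4 !mul_mat_J2 !vec4E.
by rewrite !christoffel_vec4 !vec4B /neutral !vec4E; field.
Qed.

Lemma lee_form_J3 z : lee_form mat_J3 z = - 3 * z 0 3%:R.
Proof.
rewrite /lee_form /cov_J !delta4E !christoffel_vec4 !mul_mat_J3 !vec4E.
by rewrite !christoffel_vec4 !vec4B /neutral !vec4E; field.
Qed.

Lemma W4_identity x y z :
  neutral (cov_J mat_J1 x y) z =
  2^-1 * (neutral x y * lee_form mat_J1 z - neutral x z * lee_form mat_J1 y
    - neutral x (y *m mat_J1) * lee_form mat_J1 (z *m mat_J1)
    + neutral x (z *m mat_J1) * lee_form mat_J1 (y *m mat_J1)).
Proof.
rewrite !lee_form_J1 /cov_J !mul_mat_J1 /christoffel /neutral !frame_simp.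
by field.
Qed.

(* The components of [X, Y], where [a] and [b] are the derivatives of the
   components of [Y] along [X] and of [X] along [Y]. *)
Definition alg_bracket x y a b : 'rV[R]_4 :=
  a - b + (christoffel x y - christoffel y x).

(* Here [a], [b], [c], [d] stand for the derivatives of the components of [Y]
   along [J X], of [X] along [J Y], of [Y] along [X] and of [X] along [Y]. *)
Lemma nijenhuis_identity M (x y a b c d : 'rV[R]_4) :
  M = mat_J2 \/ M = mat_J3 ->
  let N := alg_bracket in
  N (x *m M) (y *m M) (a *m M) (b *m M) - N (x *m M) y a (d *m M) *m M
  - N x (y *m M) (c *m M) b *m M - N x y c d = 0.
Proof.
move=> hM; have MM (u : 'rV[R]_4) : u *m M *m M = - u.
  by case: hM => ->; apply: row4P;
    rewrite !(mul_mat_J2, mul_mat_J3, vec4E) ?mxE.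
move=> N.
(* By M^2 = -1 each of the terms in [a], [b], [c], [d] occurs twice with opposite signs; the rest is
   the Nijenhuis expression of constant components. *)
suff -> : N (x *m M) (y *m M) (a *m M) (b *m M) - N (x *m M) y a (d *m M) *m M
    - N x (y *m M) (c *m M) b *m M - N x y c d =
  (christoffel (x *m M) (y *m M) - christoffel (y *m M) (x *m M))
  - (christoffel (x *m M) y - christoffel y (x *m M)) *m M
  - (christoffel x (y *m M) - christoffel (y *m M) x) *m M
  - (christoffel x y - christoffel y x).
  by case: hM => ->; rewrite ?mul_mat_J2 ?mul_mat_J3 /christoffel !frame_simp;
    apply: row4P; rewrite !vec4E [RHS]mxE; field.
rewrite /N /alg_bracket !(mulmxDl, mulNmx) !MM.
by apply/rowP => j; rewrite !mxE; ring.
Qed.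

Definition W1_rhs M x y z : R :=
  4^-1 * (neutral x y * lee_form M z + neutral x z * lee_form M y
    + neutral x (y *m M) * lee_form M (z *m M)
    + neutral x (z *m M) * lee_form M (y *m M)).

(** The left side is -5/4. On the right only the last summand survives, with g(x, J z) = -1 and
    theta(J y) = 3, giving -3/4. *)
Lemma W1_fails_J2
    (x := delta_mx 0 1) (y := delta_mx 0 0) (z := delta_mx 0 3%:R) :
  neutral (cov_J mat_J2 x y) z <> W1_rhs mat_J2 x y z.
Proof.
rewrite /x /y /z /W1_rhs !lee_form_J2 /cov_J !mul_mat_J2 /christoffel.
by rewrite /neutral !frame_simp; lra.
Qed.

(** Again -5/4 against -3/4, with the same surviving summand. *)
Lemma W1_fails_J3
    (x := delta_mx 0 1) (y := delta_mx 0 0) (z := delta_mx 0 2%:R) :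
  neutral (cov_J mat_J3 x y) z <> W1_rhs mat_J3 x y z.
Proof.
rewrite /x /y /z /W1_rhs !lee_form_J3 /cov_J !mul_mat_J3 /christoffel.
by rewrite /neutral !frame_simp; lra.
Qed.
End Algebra.

(** * The Levi-Civita connection *)

Section LeviCivita.
Variables (R : realType) (e : frame R) (D : vfield R -> vfield R -> vfield R).
Hypothesis e_smooth : forall i, smooth_field (e i).
Hypothesis e_unit : forall p, \matrix_(i < 4) e i p \in unitmx.
Hypothesis e_br : brackets_g e.
Hypothesis LC : levi_civita (metric e) D.

Local Notation crd := (coord e).
Local Notation cpt := (component e).

Let conD : connection D. Proof. by case: LC. Qed.
Let torD : torsion_free D. Proof. by case: LC. Qed.
Let metD : metric_compatible (metric e) D. Proof. by case: LC. Qed.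

Lemma metricE p v w : metric e p v w = neutral (crd p v) (crd p w).
Proof. by []. Qed.

Lemma bracket_anti (X Y : vfield R) p : bracket Y X p = - bracket X Y p.
Proof. by rewrite /bracket opprB. Qed.

Lemma coord_bracket_frame i j p : crd p (bracket (e i) (e j) p) =
  christoffel (delta_mx 0 i) (delta_mx 0 j)
  - christoffel (delta_mx 0 j) (delta_mx 0 i).
Proof.
have self k : bracket (e k) (e k) p = 0 by rewrite /bracket subrr.
have coord0 : crd p 0 = 0 by rewrite /coord mul0mx.
have coordN v : crd p (- v) = - crd p v by rewrite /coord mulNmx.
have [[b01 b02 b03] [b12 b13 b23]] := e_br p.
by move: i j; apply: forall_ord4; apply: forall_ord4;
  rewrite ?self ?b01 ?b02 ?b03 ?b12 ?b13 ?b23 //;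
  (* Pairs with i > j reduce to the prescribed brackets by antisymmetry. *)
  rewrite 1?bracket_anti ?b01 ?b02 ?b03 ?b12 ?b13 ?b23;
  rewrite ?coordN ?coordZ ?coord0 ?(coord_frame e_unit) // !delta4E;
  rewrite !christoffel_vec4; apply: row4P;
  rewrite ?vec4B !vec4E ?mxE ?vec4E /=; field.
Qed.

Lemma levi_civita_frame i j p :
  crd p (D (e i) (e j) p) = christoffel (delta_mx 0 i) (delta_mx 0 j).
Proof.
pose T i j k := neutral (crd p (D (e i) (e j) p)
  - christoffel (delta_mx 0 i) (delta_mx 0 j)) (delta_mx 0 k).
have neutralC (x y : 'rV[R]_4) : neutral x y = neutral y x.
  by rewrite /neutral; ring.
have neutralB (x y z : 'rV[R]_4) :
    neutral (x - y) z = neutral x z - neutral y z.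
  by rewrite /neutral !mxE; ring.
have Tsym a b c : T a b c = T b a c.
  rewrite /T; congr neutral.
  have := congr1 (fun X : vfield R => crd p (X p))
    (torD (e_smooth a) (e_smooth b)).
  rewrite /fsub coordB coord_bracket_frame => H.
  rewrite -[crd p (D (e a) (e b) p)](subrK (crd p (D (e b) (e a) p))) H.
  by rewrite addrC -addrA addKr addrC.
have Tanti a b c : T a b c = - T a c b.
  have := metD (e_smooth a) (e_smooth b) (e_smooth c) p.
  (* The metric coefficients of the frame are constant, so their derivative vanishes. *)
  rewrite /lie_deriv (_ : eval_metric _ _ _ =
    fun=> neutral (delta_mx 0 b) (delta_mx 0 c)); last first.
    by apply/funext => q; rewrite /eval_metric metricE !(coord_frame e_unit).
  rewrite derive_cst /eval_metric !metricE !(coord_frame e_unit) //.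
  have := christoffel_metric (delta_mx 0 a) (delta_mx 0 b)
    (delta_mx 0 c : 'rV[R]_4).
  rewrite /T !neutralB ![neutral (delta_mx 0 b) _]neutralC.
  by move=> h1 h2; lra.
(* T(i,j,k) = T(j,i,k) = -T(j,k,i) = -T(k,j,i) = T(k,i,j) = T(i,k,j) = -T(i,j,k). *)
have T0 k : T i j k = 0.
  have h1 := Tsym i j k; have h2 := Tanti j i k; have h3 := Tsym j k i.
  have h4 := Tanti k j i; have h5 := Tsym k i j; have h6 := Tanti i k j.
  by lra.
apply/eqP; rewrite -subr_eq0; apply/eqP.
(* Nondegeneracy: a vector orthogonal to all four frame vectors is zero. *)
have := T0 0; have := T0 1; have := T0 2%:R; have := T0 3%:R.
rewrite /T; move: (crd p _ - _) => w.
rewrite !delta4E /neutral !vec4E => h3 h2 h1 h0.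
by apply: row4P; rewrite mxE; lra.
Qed.

(** The covariant derivative, in components, of the flat connection for which the frame is
    parallel. *)
Definition flat_deriv (X Y : vfield R) (p : 'rV[R]_4) : 'rV[R]_4 :=
  \row_k lie_deriv X (cpt Y k) p.

Lemma levi_civita_coord X Y p : smooth_field X -> smooth_field Y ->
  crd p (D X Y p) = flat_deriv X Y p + christoffel (crd p (X p)) (crd p (Y p)).
Proof.
move=> sX sY.
have sc Z i : smooth_field Z -> smooth_function (cpt Z i).
  exact: smooth_component.
have sf Z i : smooth_field Z -> smooth_field (fscale (cpt Z i) (e i)).
  by move=> sZ; apply: smooth_fscale; [exact: sc|exact: e_smooth].
(* Linearity over functions in the first slot comes first; the Leibniz rule in the second slot then
   produces [flat_deriv]. *)
have DX j : crd p (D X (e j) p) =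
    christoffel (crd p (X p)) (delta_mx 0 j).
  rewrite {1}(field_expand e_unit X).
  rewrite !(conn_addl conD) ?(conn_scalel conD) //; do ?apply: smooth_fadd;
    do ?[exact: sf | exact: sc | exact: e_smooth].
  rewrite /fadd /fscale !coordD !coordZ !levi_civita_frame /component.
  move: (crd p (X p)) => x; rewrite !delta4E.
  by move: j; apply: forall_ord4; rewrite !delta4E /christoffel !vec4E;
    apply: row4P; rewrite !mxE /=; field.
rewrite {1}(field_expand e_unit Y).
rewrite !(conn_addr conD) ?(conn_leibniz conD) //; do ?apply: smooth_fadd;
  do ?[exact: sf | exact: sc | exact: e_smooth | exact: sX].
rewrite /fadd /fscale !coordD !coordZ !DX !(coord_frame e_unit).
rewrite /flat_deriv /component.
move: (crd p (X p)) (crd p (Y p)) => x y.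
by apply: row4P; rewrite !delta4E /christoffel !vec4E !mxE /=; field.
Qed.

(** * Endomorphism fields with a constant matrix in the frame *)

Section Endomorphism.
Variables (J : endo_field R) (M : 'M[R]_4).
Hypothesis coordJ : forall p v, crd p (J p v) = crd p v *m M.

Lemma coord_app X p : crd p (endo_app J X p) = crd p (X p) *m M.
Proof. exact: coordJ. Qed.

Lemma component_app X i :
  cpt (endo_app J X) i = fun p => \sum_j cpt X j p * M j i.
Proof. by apply/funext => p; rewrite /component coord_app mxE. Qed.

Lemma smooth_app X : smooth_field X -> smooth_field (endo_app J X).
Proof.
move=> sX; rewrite (field_expand e_unit (endo_app J X)).
have sf i : smooth_field (fscale (cpt (endo_app J X) i) (e i)).
  apply: smooth_fscale => // k; rewrite component_app.
  apply: is_Ck_sum => j; apply: is_CkM; last exact: is_Ck_cst.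
  exact: smooth_component.
by do !apply: smooth_fadd.
Qed.

(** Constant entries of [M] pass through the derivative; hence the derivative terms cancel in
    [nablaJ]. *)
Lemma flat_deriv_app X Y p : smooth_field Y ->
  flat_deriv X (endo_app J Y) p = flat_deriv X Y p *m M.
Proof.
move=> sY; apply/rowP => i; rewrite !mxE /lie_deriv component_app.
have dY j : derivable (cpt Y j : _ -> R^o) p (X p).
  apply: diff_derivable.
  by have [] := smooth_component e_smooth e_unit j sY 1%N.
rewrite (_ : (fun q => _) =
    \sum_j (fun q => cpt Y j q * M j i : R^o)); last first.
  by apply/funext => q; rewrite fct_sumE.
rewrite derive_sum => [|j]; last exact: derivableM.
by apply: eq_bigr => j _; rewrite deriveMr // mxE mulrC.
Qed.

Lemma coord_nablaJ X Y p : smooth_field X -> smooth_field Y ->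
  crd p (nablaJ D J X Y p) = cov_J M (crd p (X p)) (crd p (Y p)).
Proof.
move=> sX sY; have sJY := smooth_app sY.
rewrite /nablaJ /fsub coordB coord_app !levi_civita_coord //.
by rewrite flat_deriv_app // mulmxDl coord_app /cov_J opprD addrACA subrr add0r.
Qed.

Lemma FtensorE X Y Z p : smooth_field X -> smooth_field Y ->
  Ftensor (metric e) D J X Y Z p =
  neutral (cov_J M (crd p (X p)) (crd p (Y p))) (crd p (Z p)).
Proof.
by move=> sX sY; rewrite /Ftensor /eval_metric metricE coord_nablaJ.
Qed.

Lemma thetaE Z p : theta e (metric e) D J Z p = lee_form M (crd p (Z p)).
Proof.
rewrite /theta.
(* The Gram matrix of the frame, an involution and so its own inverse. *)
pose S : 'M[R]_4 := diag_mx (vec4 1 1 (-1) (-1)).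
rewrite (_ : \matrix_(k, l) _ = S); last first.
  apply/matrixP => i j; rewrite !mxE /eval_metric metricE !(coord_frame e_unit).
  by move: i j; apply: forall_ord4; apply: forall_ord4;
    rewrite !delta4E /neutral !vec4E /=; ring.
have SS : S *m S = 1%:M.
  rewrite mulmx_diag -diag_const_mx; congr diag_mx.
  by apply: row4P; rewrite !mxE /=; ring.
have -> : invmx S = S.
  have uS : S \in unitmx by case: (mulmx1_unit SS).
  by rewrite -[LHS]mulmx1 -SS mulKmx.
rewrite !sum_ord4 !FtensorE // !(coord_frame e_unit) /lee_form /S !mxE /=.
by rewrite ?mulr0n ?mulr1n !(mul0r, mul1r, mulN1r, addr0, add0r).
Qed.

(** Absence of torsion turns the bracket into a difference of covariant derivatives, whose
    components are known. *)
Lemma coord_bracket X Y p : smooth_field X -> smooth_field Y ->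
  crd p (bracket X Y p) = alg_bracket (crd p (X p)) (crd p (Y p))
    (flat_deriv X Y p) (flat_deriv Y X p).
Proof.
move=> sX sY; rewrite -(torD sX sY) /fsub coordB !levi_civita_coord //.
by rewrite /alg_bracket opprD addrACA.
Qed.

Lemma integrable_app : M = mat_J2 R \/ M = mat_J3 R -> class_W1W2 J.
Proof.
move=> hM X Y sX sY p; apply: (coord_inj e_unit (p := p)); rewrite [RHS]mul0mx.
have sJX := smooth_app sX; have sJY := smooth_app sY.
transitivity (crd p (bracket (endo_app J X) (endo_app J Y) p)
  - crd p (bracket (endo_app J X) Y p) *m M
  - crd p (bracket X (endo_app J Y) p) *m M - crd p (bracket X Y p)).
  by rewrite /nijenhuis /fsub 3!coordB; congr (_ - _ - _ - _); exact: coord_app.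
apply: etrans (nijenhuis_identity (crd p (X p)) (crd p (Y p))
  (flat_deriv (endo_app J X) Y p) (flat_deriv (endo_app J Y) X p)
  (flat_deriv X Y p) (flat_deriv Y X p) hM).
by congr (_ - _ *m M - _ *m M - _);
  rewrite coord_bracket // ?flat_deriv_app // ?coord_app.
Qed.
End Endomorphism.

(** * The matrices of the three structures *)

Lemma coord_endo a b c d (p v : 'rV[R]_4) : crd p (endo e a b c d p v) =
  crd p v *m mat4 (crd p (a p)) (crd p (b p)) (crd p (c p)) (crd p (d p)).
Proof. by rewrite mul_mat4 /endo !coordD !coordZ. Qed.

Lemma coord_fopp (X : vfield R) p : crd p (fopp X p) = - crd p (X p).
Proof. exact: mulNmx. Qed.

Lemma coord_J1 p v : crd p (J1 e p v) = crd p v *m mat_J1 R.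
Proof. by rewrite coord_endo !coord_fopp !(coord_frame e_unit). Qed.

Lemma coord_J2 p v : crd p (J2 e p v) = crd p v *m mat_J2 R.
Proof. by rewrite coord_endo !coord_fopp !(coord_frame e_unit). Qed.

Lemma coord_J3 p v : crd p (J3 e p v) = crd p v *m mat_J3 R.
Proof. by rewrite coord_endo !coord_fopp !(coord_frame e_unit). Qed.

End LeviCivita.

Theorem proposition2p6 (R : realType) (G : lie_group R) (e : frame R)
    (he : lie_basis G e) (hbr : brackets_g e)
    (nabla : vfield R -> vfield R -> vfield R)
    (hnabla : levi_civita (metric e) nabla) :
  class_H e nabla /\
  (~ class_W1 e (metric e) nabla (J2 e) /\
   ~ class_W2 e (metric e) nabla (J2 e)) /\
  (~ class_W1 e (metric e) nabla (J3 e) /\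
   ~ class_W2 e (metric e) nabla (J3 e)).
Proof.
have sm i : smooth_field (e i) by have [] := he.1 i.
have un p : \matrix_(i < 4) e i p \in unitmx by exact: frame_unitmx he.
have C1 := coord_J1 un; have C2 := coord_J2 un; have C3 := coord_J3 un.
have F := FtensorE sm un hbr hnabla; have T := thetaE sm un hbr hnabla.
split; [split|split; split].
- move=> X Y Z sX sY sZ p.
  rewrite (F _ _ C1) // !(T _ _ C1) /eval_metric !metricE !(coord_app C1).
  exact: W4_identity.
- by apply: (integrable_app sm un hbr hnabla C2); left.
- by apply: (integrable_app sm un hbr hnabla C3); right.
- move=> W1; apply: (W1_fails_J2 (R := R)).
  (* Indices start at 0, so these are e_2, e_1, e_4; the last 0 is an arbitrary base point. *)
  have := W1 _ _ _ (sm 1) (sm 0) (sm 3%:R) 0.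
  rewrite (F _ _ C2) // !(T _ _ C2) /eval_metric !metricE !(coord_app C2).
  by rewrite !(coord_frame un).
(* theta_2(e_3) = 3 contradicts the vanishing of the Lee form. *)
- move=> [_ /(_ _ (sm 2%:R) 0)]; rewrite (T _ _ C2) (coord_frame un).
  by rewrite lee_form_J2 delta4E vec4E; lra.
- move=> W1; apply: (W1_fails_J3 (R := R)).
  have := W1 _ _ _ (sm 1) (sm 0) (sm 2%:R) 0.
  rewrite (F _ _ C3) // !(T _ _ C3) /eval_metric !metricE !(coord_app C3).
  by rewrite !(coord_frame un).
(* Likewise theta_3(e_4) = -3. *)
- move=> [_ /(_ _ (sm 3%:R) 0)]; rewrite (T _ _ C3) (coord_frame un).
  by rewrite lee_form_J3 delta4E vec4E; lra.
Qed.
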